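(* There exist an absolute constant $C>0$ and, for every prime power $q$ and every integer $d\ge2$, a number $\lambda_q(d)$ with $$q^{-C}\,\frac{d}{\log d}\le\lambda_q(d)\le q^{C}\,\frac{d}{\log d},$$ such that every minimal generating set $S\subset\mathbb{F}_q[X]$ with $\deg f\le d$ for all $f\in S$ satisfies $|S|\le\lambda_q(d)$, and such that equality is achieved: for every prime power $q$ and every integer $d\ge 2$ there exists a minimal generating set $S\subset\mathbb{F}_q[X]$ with $\deg f\le d$ for all $f\in S$ and $|S|=\lambda_q(d)$.
   Context: $\mathbb{F}_q$ is the finite field with $q$ elements. A set $S\subset\mathbb{F}_q[X]$ is called a minimal generating set if it is minimal with respect to set containment among generating sets of the ideal $(S)$ it generates; that is, no proper subset $S'\subsetneq S$ generates $(S)$. *)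

(* Defs.v *)
From HB Require Import structures.
From mathcomp Require Import all_boot all_order all_algebra.
From mathcomp Require Import all_classical all_reals all_analysis.

Set Implicit Arguments.
Unset Strict Implicit.
Unset Printing Implicit Defensive.

Import Order.TTheory GRing.Theory Num.Theory.

Local Open Scope classical_set_scope.
Local Open Scope ring_scope.

(* MathComp's [idealr_closed] requires 1 to be outside the ideal; the unit
   ideal is allowed here. *)
Definition is_ideal (A : comNzRingType) (I : set A) : Prop :=
  I 0 /\ forall a u v : A, I u -> I v -> I (a * u + v).

Definition ideal_gen (A : comNzRingType) (S : set A) : set A :=
  smallest (@is_ideal A) S.

Definition minimal_generating_set (A : comNzRingType) (S : set A) : Prop :=
  forall S' : set A, S' `<` S -> ideal_gen S' <> ideal_gen S.

(* deg f <= d, with the convention deg 0 = -oo. *)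
Definition deg_le (A : nzRingType) (d : nat) (f : {poly A}) : Prop :=
  (size f <= d.+1)%N.

Definition prime_power (q : nat) : Prop :=
  exists p k : nat, [/\ prime p, (0 < k)%N & q = (p ^ k)%N].

(* Main.v *)
(* Divide a minimal generating set S by its gcd. Each f in S then has a prime p_f
   dividing every element of S except f, so f is divisible by the product of the
   p_g, g <> f, and the p_f are distinct. Conversely, for distinct primes p_1, ...,
   p_n with product P, the set {P / p_i} is minimal. Hence lambda_q(d) is the
   largest n for which some n distinct monic irreducibles satisfy
   sum_{j <> i} deg p_j <= d for every i.
   Upper bound: fewer than q^k + 1 of the p_j have degree below k, so
   k (n - 1 - q^k) <= d; take q^k about sqrt d. Lower bound: use all irreducible
   factors of X^(q^k) - X, whose degrees sum to q^k and are at most k, with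
   q^k <= d < q^(k+1). The factorization of X^(q^k) - X also shows that the number
   of irreducibles of each degree depends only on q. *)
Require Import Defs.
From HB Require Import structures.
From mathcomp Require Import all_boot all_order all_algebra all_solvable all_field.
From mathcomp Require Import all_classical all_reals all_analysis.
From mathcomp Require Import finmap ring lra zify.

Set Implicit Arguments.
Unset Strict Implicit.
Unset Printing Implicit Defensive.

Import Order.TTheory GRing.Theory Num.Theory.

Local Open Scope classical_set_scope.
Local Open Scope card_scope.
Local Open Scope ring_scope.

Local Notation deg p := (size (polyseq p)).-1.

(** * Monic irreducible polynomials over a finite field *)

Definition monic_irred (F : finFieldType) (p : {poly F}) : bool :=
  (p \is monic) && irreducibleb p.

Section MonicIrreducible.
Variable F : finFieldType.
Implicit Types (p g : {poly F}) (s : seq {poly F}).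

Lemma monic_irredP p :
  reflect (irreducible_poly p /\ p \is monic) (monic_irred p).
Proof.
by apply: (iffP andP) => [[mon_p /irreducibleP irr_p]|[/irreducibleP]].
Qed.

Lemma monic_irred_neq0 p : monic_irred p -> p != 0.
Proof. by case/andP=> /monic_neq0. Qed.

Lemma monic_irred_deg_gt0 p : monic_irred p -> (0 < (deg p))%N.
Proof. by case/monic_irredP => -[]; case: size => [|[]]. Qed.

Lemma monic_irredX : monic_irred ('X : {poly F}).
Proof.
apply/monic_irredP; split; last exact: monicX.
by rewrite -['X]subr0; apply: irredp_XsubC.
Qed.

Lemma coprimep_monic_irred p g : monic_irred p -> coprimep p g = ~~ (p %| g).
Proof. by case/monic_irredP=> irr_p _; apply: irreducible_poly_coprime. Qed.

Lemma dvdp_monic_irred p g :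
  monic_irred p -> monic_irred g -> (p %| g) = (p == g).
Proof.
move=> /monic_irredP[irr_p mon_p] /monic_irredP[irr_g mon_g].
apply/idP/eqP => [/(irr_g _ _)|->//]; rewrite eqp_monic // => pg.
by apply/eqP/pg; case: irr_p => + _; case: size => [|[]].
Qed.

Lemma dvdp_prod_monic_irred p s : monic_irred p -> all (@monic_irred F) s ->
  (p %| \prod_(r <- s) r) = (p \in s).
Proof.
move=> irr_p; elim: s => [_|g s IHs /= /andP[irr_g irr_s]].
  rewrite big_nil in_nil dvdp1; apply/negP => /eqP sz_p.
  by have := monic_irred_deg_gt0 irr_p; rewrite sz_p.
rewrite big_cons inE -IHs // -(dvdp_monic_irred irr_p irr_g).
case: (boolP (p %| g)) => [/dvdp_mulr->//|].
by rewrite -coprimep_monic_irred // => /Gauss_dvdpr ->.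
Qed.

Lemma prod_monic_irred_dvdp s g : uniq s -> all (@monic_irred F) s ->
  {in s, forall p, p %| g} -> \prod_(p <- s) p %| g.
Proof.
elim: s => [|p s IHs]; first by rewrite big_nil dvd1p.
rewrite big_cons /= => /andP[ps us] /andP[irr_p irr_s] sg.
rewrite Gauss_dvdp.
  by rewrite sg ?mem_head // IHs // => r rs; rewrite sg // inE rs orbT.
by rewrite coprimep_monic_irred // dvdp_prod_monic_irred.
Qed.

Lemma deg_prod_monic_irred s : all (@monic_irred F) s ->
  (deg (\prod_(p <- s) p)) = (\sum_(p <- s) (deg p))%N.
Proof.
elim: s => [|p s IHs]; first by rewrite !big_nil size_poly1.
move=> /= /andP[irr_p irr_s]; rewrite !big_cons -IHs //.
have p0 := monic_irred_neq0 irr_p.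
have s0 : \prod_(r <- s) r != 0.
  by rewrite prodf_seq_neq0; apply/allP => r /(allP irr_s) /monic_irred_neq0.
rewrite size_mul //; move: p0 s0; rewrite -!size_poly_eq0.
by case: size => // a; case: size => // b; rewrite addSn addnS.
Qed.

(** Strong induction on the size: an irreducible [g] is scaled to be monic, a reducible one has a
    smaller nonconstant divisor. The hypothesis admits [g = 0], which ['X] divides. *)
Lemma exists_monic_irred_dvdp g : size g != 1 -> exists2 p, monic_irred p & p %| g.
Proof.
case: (eqVneq g 0) => [-> _|].
  by exists 'X; [exact: monic_irredX | rewrite dvdp0].
have [n] := ubnP (size g); elim: n g => // n IHn g lt_gn g0 g1.
case: (boolP (irreducibleb g)) => [irr_g|].
  have lg0 : lead_coef g != 0 by rewrite lead_coef_eq0.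
  have eq_g : (lead_coef g)^-1 *: g %= g by rewrite eqp_scale ?invr_eq0.
  exists ((lead_coef g)^-1 *: g); last by rewrite (eqp_dvdl _ eq_g).
  apply/monic_irredP; split; last by rewrite monicE lead_coefZ mulVf.
  have /irreducibleP[sz_g irr] := irr_g.
  split; first by rewrite (eqp_size eq_g).
  by move=> r r1; rewrite (eqp_dvdr _ eq_g) (eqp_rtrans eq_g); apply: irr.
rewrite negb_and -leqNgt => /orP[|].
  by move: g0 g1; rewrite -size_poly_eq0; case: size => [|[]].
rewrite negb_forall => /existsP[r]; rewrite negb_imply -ltnNge.
rewrite -Pdiv.Idomain.dvdpE => /andP[rg r1].
have r_small : (size r < size g)%N.
  by apply: leq_ltn_trans (size_npoly r) _; rewrite ltn_predL lt0n size_poly_eq0.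
have [||p irr_p pr] := IHn r (leq_trans r_small lt_gn).
- by rewrite -size_poly_gt0 ltnW.
- by rewrite gtn_eqF.
by exists p => //; apply: dvdp_trans rg.
Qed.

End MonicIrreducible.

(** * Counting irreducibles through the factors of ['X^(q ^ k) - 'X] *)

Section DegreeCount.
Variable F : finFieldType.
Implicit Types (p g : {poly F}) (k m : nat).
Local Notation q := #|F|.

Lemma card_pnat_pchar k : [pchar {poly F}].-nat (q ^ k)%N.
Proof.
have [p p_pr pF] := finPcharP F.
rewrite (eq_pnat _ (pchar_poly F)) (eq_pnat _ (pcharf_eq pF)) pnatX.
by have := pprimeChar_pgroup pF; rewrite /pgroup cardsT => ->.
Qed.

(** Modulo [p], the power map of exponent [q ^ k] is additive and multiplicative, fixes constants
    and, by hypothesis, fixes ['X]; hence it fixes every polynomial. *)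
Lemma frobenius_dvdp p k : p %| 'X^(q ^ k) - 'X ->
  forall g, p %| g ^+ (q ^ k) - g.
Proof.
move=> pX; elim/poly_ind => [|g c IHg].
  by rewrite expr0n expn_eq0 -leqn0 leqNgt (ltnW (finNzRing_gt1 F)) subr0.
have cq : c ^+ (q ^ k) = c.
  by elim: k {pX IHg} => //= k IHk; rewrite expnSr exprM IHk expf_card.
rewrite exprDn_pchar ?card_pnat_pchar // exprMn -polyC_exp cq.
have -> : g ^+ (q ^ k) * 'X^(q ^ k) + c%:P - (g * 'X + c%:P) =
  g ^+ (q ^ k) * ('X^(q ^ k) - 'X) + 'X * (g ^+ (q ^ k) - g).
  by move: (g ^+ _) ('X^_) => a b; ring.
by rewrite dvdp_add // dvdp_mull.
Qed.

Lemma expf_card_exp (L : finFieldType) (x : L) k : x ^+ (#|L| ^ k) = x.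
Proof. by elim: k => // k IHk; rewrite expnSr exprM IHk expf_card. Qed.

Lemma dvdp_qfpoly p (hI : monic_irreducible_poly p) g :
  (p %| g) = (in_qpoly p g == 0).
Proof.
by rewrite Pdiv.Idomain.dvdpE -val_eqE /= mk_monicE.
Qed.

(** The residue field of [p] has [q ^ deg p] elements, and [p] divides [g ^+ n - g] exactly when the
    power map of exponent [n] fixes the residue of [g]. *)
Lemma dvdp_frobenius p k : monic_irred p ->
  (p %| 'X^(q ^ k) - 'X) = ((deg p) %| k)%N.
Proof.
move=> irr_p; have m_gt0 := monic_irred_deg_gt0 irr_p.
have hI : monic_irreducible_poly p by case/monic_irredP: irr_p.
pose L : finFieldType := {poly %/ p with hI}; set m := (deg p).
have cardL : #|L| = (q ^ m)%N by apply: card_qfpoly.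
have fixL (y : L) t : y ^+ ((q ^ m) ^ t) = y by rewrite -cardL expf_card_exp.
have frob n g : (p %| g ^+ n - g) = ((in_qpoly p g : L) ^+ n == in_qpoly p g).
  by rewrite (dvdp_qfpoly hI) rmorphB rmorphXn subr_eq0.
apply/idP/idP => [/frobenius_dvdp pX|/dvdnP[t ->]]; last first.
  by rewrite frob [(t * m)%N]mulnC expnM; apply/eqP/fixL.
(* If the residue [k %% m] were positive, its Frobenius power would fix more
   elements of [L] than the degree of ['X^(q ^ (k %% m)) - 'X] allows. *)
have Lk (y : L) : y ^+ (q ^ (k %% m)) = y.
  have -> : y = in_qpoly p (val y).
    apply/val_inj/esym/in_qpoly_small.
    by rewrite (leq_ltn_trans (size_npoly y)) // prednK // size_mk_monic_gt0.
  have := pX (val y); rewrite frob => /eqP.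
  rewrite {1}(divn_eq k m) expnD [(k %/ m * m)%N]mulnC expnM exprM.
  by rewrite (fixL (in_qpoly p (val y) : L)).
rewrite /dvdn; case: (posnP (k %% m)) => // r_gt0.
have r_lt : (k %% m < m)%N by rewrite ltn_mod.
have q_gt1 : (1 < q)%N := finNzRing_gt1 F.
have Q_gt1 : (1 < q ^ (k %% m))%N by rewrite -{1}(expn0 q) ltn_exp2l.
have szX : size ('X^(q ^ (k %% m)) - 'X : {poly L}) = (q ^ (k %% m)).+1.
  by rewrite size_polyDl ?size_polyXn // size_polyN size_polyX.
have := @max_poly_roots L ('X^(q ^ (k %% m)) - 'X) (enum L).
rewrite szX -cardE cardL ltnS leq_exp2l // leqNgt r_lt.
apply; [by rewrite -size_poly_eq0 szX | | exact: enum_uniq].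
by apply/allP => y _; rewrite rootE !hornerE Lk subrr.
Qed.

(** The derivative is -1, because [q ^ k] vanishes in [F] once [k] is positive. *)
Lemma separable_frobenius k : (0 < k)%N ->
  separable_poly ('X^(q ^ k) - 'X : {poly F}).
Proof.
move=> k_gt0; rewrite unlock derivB derivXn derivX.
have [p p_pr pF] := finPcharP F.
have -> : 'X^((q ^ k).-1) *+ (q ^ k) = 0 :> {poly F}.
  have := pprimeChar_pgroup pF; rewrite /pgroup cardsT => /p_natP[e Dq].
  have qF : (q ^ k)%:R == 0 :> F.
    rewrite -(dvdn_pcharf pF) Dq -expnM dvdn_exp // muln_gt0 k_gt0 andbT.
    by have := finNzRing_gt1 F; rewrite /= Dq; case: (e).
  by rewrite -mulr_natr -polyC_natr (eqP qF) mulr0.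
rewrite sub0r /separable_poly -[X in coprimep _ X]scaleN1r coprimepZr.
  by rewrite coprimep1.
by rewrite oppr_eq0 oner_eq0.
Qed.

Definition monic_irreds k : seq {poly F} :=
  [seq p <- map val (enum {poly_(k.+1) F}) | monic_irred p & (deg p) == k].

Lemma mem_monic_irreds k p :
  (p \in monic_irreds k) = monic_irred p && ((deg p) == k).
Proof.
rewrite mem_filter; apply: andb_idr => /andP[irr_p /eqP sz_p].
have szp : (size p <= k.+1)%N by rewrite -sz_p leqSpred.
apply/mapP; by exists (NPoly szp); rewrite // mem_enum.
Qed.

Lemma uniq_monic_irreds k : uniq (monic_irreds k).
Proof. by rewrite filter_uniq // map_inj_uniq ?enum_uniq //; apply: val_inj. Qed.

(* The monic irreducible factors of 'X^(q ^ k) - 'X. *)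
Definition frobenius_factors k : seq {poly F} :=
  [seq p | d <- divisors k, p <- monic_irreds d].

Lemma mem_frobenius_factors k p : (0 < k)%N ->
  (p \in frobenius_factors k) = monic_irred p && ((deg p) %| k)%N.
Proof.
move=> k_gt0; apply/allpairsPdep/andP => [[d [g [dk gd ->]]]|[irr_p pk]].
  by move: gd; rewrite mem_monic_irreds dvdn_divisors // => /andP[-> /eqP->].
by exists (deg p), p; rewrite -dvdn_divisors // mem_monic_irreds irr_p eqxx.
Qed.

Lemma uniq_frobenius_factors k : uniq (frobenius_factors k).
Proof.
apply: allpairs_uniq_dep => [|d _|]; first exact: divisors_uniq.
  exact: uniq_monic_irreds.
move=> _ _ /allpairsPdep[d [p [_ pd ->]]] /allpairsPdep[e [g [_ ge ->]]] /= pg.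
move: pd ge; rewrite -{}pg !mem_monic_irreds => /andP[_ /eqP <-].
by move=> /andP[_ /eqP <-].
Qed.

(** The product of these distinct irreducibles divides ['X^(q ^ k) - 'X]. A nonconstant cofactor
    would have an irreducible factor already in the list, so a square would divide a separable
    polynomial. Comparing degrees gives the sum. *)
Lemma sum_deg_frobenius_factors k : (0 < k)%N ->
  (\sum_(p <- frobenius_factors k) (deg p) = q ^ k)%N.
Proof.
move=> k_gt0; set s := frobenius_factors k; set g : {poly F} := 'X^(q ^ k) - 'X.
have irr_s : all (@monic_irred F) s.
  by apply/allP => p; rewrite mem_frobenius_factors // => /andP[].
have Q_gt1 : (1 < q ^ k)%N.
  by rewrite -{1}(expn0 q) ltn_exp2l // finNzRing_gt1.
have szg : size g = (q ^ k).+1.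
  by rewrite /g size_polyDl ?size_polyXn // size_polyN size_polyX.
have g0 : g != 0 by rewrite -size_poly_eq0 szg.
have : \prod_(p <- s) p %| g.
  apply: prod_monic_irred_dvdp => //; first exact: uniq_frobenius_factors.
  by move=> p; rewrite mem_frobenius_factors // => /andP[irr_p]; rewrite dvdp_frobenius.
rewrite -deg_prod_monic_irred // => /dvdpP[u Dg].
suff /eqP u1 : size u == 1%N.
  have u0 : u != 0 by rewrite -size_poly_eq0 u1.
  have s0 : \prod_(p <- s) p != 0.
    by apply: contraNneq g0 => s0; rewrite Dg s0 mulr0.
  by have := szg; rewrite Dg size_mul // u1 add1n /= => ->.
apply: contraT => /exists_monic_irred_dvdp[p irr_p pu].
have ps : p \in s.
  rewrite mem_frobenius_factors // irr_p -dvdp_frobenius // -/g Dg.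
  exact: dvdp_mulr.
have : p ^+ 2 %| g by rewrite Dg expr2 dvdp_mul // dvdp_prod_monic_irred.
rewrite (separable_nosquare (separable_frobenius k_gt0)) //.
by case/monic_irredP: irr_p => -[]; case: size => [|[]].
Qed.

Lemma sum_card_monic_irreds k : (0 < k)%N ->
  (\sum_(d <- divisors k) size (monic_irreds d) * d = q ^ k)%N.
Proof.
move=> k_gt0; rewrite -sum_deg_frobenius_factors // big_allpairs_dep /=.
apply: eq_bigr => d _; rewrite -sum1_size big_distrl /= !big_seq.
apply: eq_bigr => p; rewrite mem_monic_irreds => /andP[_ /eqP ->].
by rewrite mul1n.
Qed.

End DegreeCount.

(** Strong induction on [k]: in [sum_card_monic_irreds] the terms at proper divisors of [k] agree
    for both fields, hence so does the term at [k]. *)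
Lemma size_monic_irreds_eq (F F' : finFieldType) k :
  #|F| = #|F'| -> size (monic_irreds F k) = size (monic_irreds F' k).
Proof.
move=> eqFF'; elim/ltn_ind: k => -[_|k IHk].
  suff irr0 (E : finFieldType) : monic_irreds E 0 = [::] by rewrite !irr0.
  rewrite /monic_irreds (@eq_filter _ _ pred0) ?filter_pred0 // => p /=.
  by apply/andP => -[/monic_irred_deg_gt0]; case: _.-1.
have := sum_card_monic_irreds F' (ltn0Sn k).
rewrite -eqFF' -(sum_card_monic_irreds F) //.
have kk : k.+1 \in divisors k.+1 by rewrite -dvdn_divisors.
rewrite !(bigD1_seq k.+1 kk (divisors_uniq _)) /=.
suff -> : (\sum_(d <- divisors k.+1 | d != k.+1) size (monic_irreds F d) * d =
  \sum_(d <- divisors k.+1 | d != k.+1) size (monic_irreds F' d) * d)%N.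
  by move/addIn/eqP; rewrite eqn_pmul2r // => /eqP.
rewrite big_seq_cond [RHS]big_seq_cond; apply: eq_bigr => d /andP[dk d_neq].
rewrite IHk // ltn_neqAle d_neq dvdn_leq //.
by rewrite -dvdn_divisors in dk.
Qed.

(** * Families of irreducibles with bounded degree sums *)

(** Adding the degree of [p] on the right stands for omitting [p] from the sum: the degrees of all
    members but one add up to at most [d]. *)
Definition irred_family (F : finFieldType) (d : nat) (s : seq {poly F}) : bool :=
  [&& uniq s, all (@monic_irred F) s &
      all (fun p => \sum_(r <- s) (deg r) <= d + (deg p))%N s].

(** The first member is set aside, whence the successor in [(#|F| ^ k).+1]. Of the rest, at most
    [#|F| ^ k] have degree below [k], and each other one adds at least [k] to a sum bounded by
    [d]. *)
Lemma irred_family_leq (F : finFieldType) d (s : seq {poly F}) k :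
  irred_family d s -> (k * size s <= d + k * (#|F| ^ k).+1)%N.
Proof.
case: s => [|p s]; first by rewrite muln0.
case/and3P => /andP[_ us] /= /andP[_ irr_s] /andP[+ _].
rewrite big_cons addnC leq_add2r => sum_le; rewrite /= !mulnS addnCA leq_add2l.
have cnt : (count (fun r : {poly F} => size r <= k)%N s <= #|F| ^ k)%N.
  rewrite -size_filter -card_npoly cardE -[leqRHS](size_map val).
  apply: uniq_leq_size; first exact: filter_uniq.
  move=> r; rewrite mem_filter => /andP[rk _].
  by apply/mapP; exists (NPoly rk); rewrite ?mem_enum.
rewrite -(count_predC (fun r : {poly F} => size r <= k)%N s) mulnDr.
suff : (k * count (predC (fun r : {poly F} => size r <= k)) s
  <= \sum_(r <- s) (deg r))%N.
  by move=> /leq_trans/(_ sum_le) le_d; rewrite addnC leq_add // leq_mul2l cnt orbT.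
rewrite -sum1_count big_distrr /= [leqRHS](bigID (fun r : {poly F} => (k < size r)%N)) /=.
rewrite -[leqLHS]addn0 leq_add //.
rewrite (eq_bigl (fun r : {poly F} => (k < size r)%N)); last first.
  by move=> r; rewrite /= ltnNge.
by apply: leq_sum => r; rewrite muln1; case: size.
Qed.

(** All degrees are positive. This crude bound justifies the range of the maximum in
    [max_family_size]. *)
Lemma size_irred_family (F : finFieldType) d (s : seq {poly F}) :
  irred_family d s -> (size s <= d.+1)%N.
Proof.
case: s => // p s; case/and3P => /= _ /andP[_ irr_s] /andP[+ _].
rewrite big_cons addnC leq_add2r ltnS; apply: leq_trans.
rewrite -sum1_size !big_seq leq_sum // => r /(allP irr_s).
exact: monic_irred_deg_gt0.
Qed.

(* Transport along a degree-preserving bijection of the monic irreducibles. *)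
Lemma irred_family_card (F F' : finFieldType) d (s : seq {poly F}) :
  #|F| = #|F'| -> irred_family d s ->
  exists2 s' : seq {poly F'}, irred_family d s' & size s' = size s.
Proof.
move=> cardFF' /and3P[us irr_s sum_s].
(* [phi] keeps the degree and the position in the list of monic irreducibles of that degree. *)
pose phi (p : {poly F}) : {poly F'} :=
  nth 0 (monic_irreds F' (deg p)) (index p (monic_irreds F (deg p))).
have idx p : p \in s ->
    (index p (monic_irreds F (deg p)) < size (monic_irreds F' (deg p)))%N.
  move=> ps; rewrite -(size_monic_irreds_eq _ cardFF') index_mem.
  by rewrite mem_monic_irreds (allP irr_s) /=.
have phiP p : p \in s -> monic_irred (phi p) /\ (deg (phi p)) = (deg p).
  move=> /idx /(mem_nth 0); rewrite -/(phi p) mem_monic_irreds.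
  by move=> /andP[-> /eqP].
exists (map phi s); last by rewrite size_map.
have deg_phi : (\sum_(r <- map phi s) (deg r) = \sum_(r <- s) (deg r))%N.
  rewrite big_map !big_seq; apply: eq_bigr => r rs.
  by have [] := phiP r rs.
apply/and3P; split.
- rewrite map_inj_in_uniq // => p r ps rs pr.
  have deg_pr : (deg p) = (deg r).
    by have [_ <-] := phiP p ps; have [_ <-] := phiP r rs; rewrite pr.
  have := pr; rewrite /phi => /eqP; rewrite -deg_pr.
  rewrite nth_uniq ?uniq_monic_irreds ?idx // => [/eqP eq_idx|].
    have pm : p \in monic_irreds F (deg p).
      by rewrite mem_monic_irreds (allP irr_s) /=.
    have rm : r \in monic_irreds F (deg p).
      by rewrite mem_monic_irreds (allP irr_s) // deg_pr /=.
    by rewrite -(nth_index 0 pm) eq_idx nth_index.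
  by rewrite deg_pr idx.
- by apply/allP => _ /mapP[p ps ->]; have [] := phiP p ps.
- apply/allP => _ /mapP[p ps ->]; rewrite deg_phi.
  have [_ ->] := phiP p ps; exact: (allP sum_s).
Qed.

Lemma irred_family_frobenius (F : finFieldType) d k :
  (0 < k)%N -> (#|F| ^ k <= d)%N -> irred_family d (frobenius_factors F k).
Proof.
move=> k_gt0 qk; apply/and3P; split; first exact: uniq_frobenius_factors.
  by apply/allP => p; rewrite mem_frobenius_factors // => /andP[].
apply/allP => p _; rewrite sum_deg_frobenius_factors //.
exact: leq_trans (leq_addr _ _).
Qed.

Lemma size_frobenius_factors (F : finFieldType) k :
  (0 < k)%N -> (#|F| ^ k <= k * size (frobenius_factors F k))%N.
Proof.
move=> k_gt0; rewrite -sum_deg_frobenius_factors // -sum1_size big_distrr /=.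
rewrite !big_seq leq_sum // => p; rewrite mem_frobenius_factors // muln1.
by move=> /andP[_ /dvdn_leq->].
Qed.

(** Serves the case [d < #|F|], where no positive [k] satisfies [#|F| ^ k <= d]. *)
Lemma irred_family_linear (F : finFieldType) d :
  (d <= #|F|)%N -> irred_family d (take d (monic_irreds F 1)).
Proof.
move=> dq; apply/and3P; split; first exact: take_uniq (uniq_monic_irreds F 1).
  by apply/allP => p /mem_take; rewrite mem_monic_irreds => /andP[].
apply/allP => p _; apply: leq_trans (leq_addr _ _).
rewrite big_seq (eq_bigr (fun=> 1%N)); last first.
  by move=> r /mem_take; rewrite mem_monic_irreds => /andP[_ /eqP].
by rewrite -big_seq sum1_size size_take_min geq_minl.
Qed.

Lemma size_monic_irreds1 (F : finFieldType) : size (monic_irreds F 1) = #|F|.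
Proof. by have := sum_card_monic_irreds F (ltn0Sn 0); rewrite big_seq1 muln1. Qed.

(* Quantifying over all fields of cardinality q makes this depend on q and d only. *)
Definition max_family_size (q d : nat) : nat :=
  \max_(n < d.+2 | `[< exists (F : finFieldType) (s : seq {poly F}),
    [/\ #|F| = q, irred_family d s & size s = n] >]) n.

Lemma leq_max_family_size (F : finFieldType) d (s : seq {poly F}) :
  irred_family d s -> (size s <= max_family_size #|F| d)%N.
Proof.
move=> fam_s; have sz_s : (size s < d.+2)%N by rewrite ltnS size_irred_family.
apply: (@leq_bigmax_cond _ _ _ (Ordinal sz_s)).
by apply/asboolP; exists F, s.
Qed.

(** The maximum may come from another field of the same cardinality; [irred_family_card] carries the
    family over to [F]. *)
Lemma max_family_size_attained (F : finFieldType) d :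
  exists2 s : seq {poly F}, irred_family d s & size s = max_family_size #|F| d.
Proof.
rewrite /max_family_size.
pose P (n : 'I_d.+2) := `[< exists (E : finFieldType) (s : seq {poly E}),
    [/\ #|E| = #|F|, irred_family d s & size s = n] >].
have P0 : P ord0 by apply/asboolP; exists F, [::].
rewrite (@bigop.bigmax_eq_arg _ ord0 P) //; case: arg_maxnP => //= n /asboolP.
move=> [E [s [cardE fam_s sz_s]]] _.
by have [s' fam_s' sz_s'] := irred_family_card cardE fam_s; exists s'; rewrite ?sz_s'.
Qed.

(** The [maxn 1] covers [d < #|F|], where the truncated logarithm is zero and linear polynomials
    supply [d] members. *)
Lemma max_family_size_lower (F : finFieldType) d : (0 < d)%N ->
  (d <= #|F| * maxn 1 (trunc_log #|F| d) * max_family_size #|F| d)%N.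
Proof.
move=> d_gt0; have q_gt1 : (1 < #|F|)%N := finNzRing_gt1 F.
have /andP[] := trunc_log_bounds q_gt1 d_gt0; set k := trunc_log _ d.
case: (posnP k) => [-> _|k_gt0 qk dq].
  rewrite expn1 => dq; have /leq_max_family_size := irred_family_linear (ltnW dq).
  rewrite size_takel ?size_monic_irreds1 ?(ltnW dq) // muln1.
  by move=> /leq_trans-> //; apply: leq_pmull; apply: ltnW.
have := leq_max_family_size (irred_family_frobenius k_gt0 qk).
have := size_frobenius_factors F k_gt0.
move: dq; rewrite expnS; have -> : maxn 1 k = k by apply/maxn_idPr.
move=> /ltnW /leq_trans le_d sz /(leq_mul (leqnn k)) le_max.
by apply: le_d; rewrite -mulnA leq_pmul2l ?(ltnW q_gt1) // (leq_trans sz).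
Qed.

Lemma max_family_size_upper (F : finFieldType) d : (0 < d)%N ->
  ((trunc_log #|F| d).+1 * max_family_size #|F| d <= #|F| ^ 4 * d)%N.
Proof.
move=> d_gt0; have q_gt1 : (1 < #|F|)%N := finNzRing_gt1 F.
have /andP[qk _] := trunc_log_bounds q_gt1 d_gt0; move: qk; set k := trunc_log _ d.
have [s fam_s <-] := max_family_size_attained F d.
(* Half the logarithm is taken so that [j * q ^ j <= q ^ j * q ^ j <= q ^ k <= d]. *)
have := irred_family_leq (k./2) fam_s; have := size_irred_family fam_s.
set j := k./2 => szd jsz qk.
have jqj : (j * #|F| ^ j <= d)%N.
  apply: leq_trans qk; apply: (@leq_trans (#|F| ^ j * #|F| ^ j)).
    by rewrite leq_mul2r orbC ltnW // ltn_expl.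
  by rewrite -expnD leq_exp2l // addnn -[leqRHS](odd_double_half k) leq_addl.
have jd : (j <= d)%N by apply: leq_trans jqj; rewrite leq_pmulr // expn_gt0 ltnW.
have k2 : (k.+1 <= j.*2.+2)%N.
  by rewrite -(odd_double_half k) -/j; case: odd; rewrite /= ?addn0.
have q16 : (2 ^ 4 <= #|F| ^ 4)%N by rewrite leq_exp2r.
apply: leq_trans (leq_mul q16 (leqnn d)).
apply: leq_trans (leq_mul k2 (leqnn _)) _.
(* For a family of size [n], [j * n <= 3 * d] and [n <= d + 1 <= 2 * d], so [(2 * j + 2) * n] is at
   most [10 * d], within [2 ^ 4 * d]. *)
rewrite mulnS in jsz; lia.
Qed.

(** * Generated ideals in a commutative ring *)

Section IdealGen.
Variable A : comNzRingType.
Implicit Types (S T I : set A).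

Lemma ideal_gen_is_ideal S : is_ideal (ideal_gen S).
Proof.
split=> [I [[I0 _] _]//|a u v Su Sv I [idI SI]].
by have [_] := idI; apply; [apply: Su | apply: Sv].
Qed.

Lemma is_ideal_mull I a u : is_ideal I -> I u -> I (a * u).
Proof. by move=> [I0 IM] Iu; rewrite -[a * u]addr0; apply: IM. Qed.

(** Otherwise the proper subset left after removing [f] would generate the same ideal. *)
Lemma minimal_generating_set_notin S f : minimal_generating_set S -> S f ->
  ~ ideal_gen (S `\ f) f.
Proof.
move=> minS Sf genf.
have prop : S `\ f `<` S.
  by split; [exact: subDsetl | move=> /(_ f Sf) [_]; apply].
apply: (minS _ prop); apply/seteqP; split.
  by apply: sub_smallest2r; [exact: ideal_gen_is_ideal | exact: subDsetl].
apply: smallest_sub; first exact: ideal_gen_is_ideal.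
move=> g Sg; have [->//|gf] := eqVneq g f.
by apply: sub_gen_smallest; split=> //; apply/eqP.
Qed.

End IdealGen.

(** * Minimal generating sets of polynomials and families of irreducibles *)

Section Polynomials.
Variable F : finFieldType.
Implicit Types (p g f : {poly F}) (s : seq {poly F}) (S I : set {poly F}).

Lemma dvdp_is_ideal p : is_ideal [set g | p %| g].
Proof. by split=> [|a u v pu pv] /=; rewrite ?dvdp0 // dvdp_add // dvdp_mull. Qed.

Lemma ideal_gen_dvdp p S g : (forall f, S f -> p %| f) -> ideal_gen S g -> p %| g.
Proof.
by move=> pS; apply: (smallest_sub (dvdp_is_ideal p)) => f; apply: pS.
Qed.

(** Iterated Bezout: a gcd of [s] is a combination of its members. The empty list yields 0. *)
Lemma is_ideal_common_divisor I s : is_ideal I -> (forall f, f \in s -> I f) ->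
  exists2 g, I g & forall f, f \in s -> g %| f.
Proof.
move=> idI; elim: s => [_|f s IHs sI]; first by exists 0; [case: idI|].
have [h hs|g Ig gs] := IHs; first by apply: sI; rewrite inE hs orbT.
have [u gcd_fg] := Bezoutp f g.
exists (u.1 * f + u.2 * g).
  have [_] := idI; apply; first by apply: sI; rewrite mem_head.
  exact: is_ideal_mull.
move=> h; rewrite (eqp_dvdl _ gcd_fg) inE => /predU1P[->|/gs gh].
  exact: dvdp_gcdl.
exact: dvdp_trans (dvdp_gcdr _ _) gh.
Qed.

(* [G] is the gcd of [s], and [p] is a prime at which [f] alone has the
   smallest valuation. *)
Lemma minimal_generating_set_primes s : minimal_generating_set [set` s] ->
  exists G, forall f, f \in s -> G %| f /\ exists p,
    [/\ monic_irred p, ~~ (p * G %| f) &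
        forall g, g \in s -> g != f -> p * G %| g].
Proof.
move=> mins; have sub_s f : f \in s -> ideal_gen [set` s] f.
  by move=> fs; apply: sub_gen_smallest.
have [G genG Gs] := is_ideal_common_divisor (ideal_gen_is_ideal _) sub_s.
exists G => f fs; split; first exact: Gs.
have nf := minimal_generating_set_notin mins fs.
pose t := [seq g <- s | g != f].
have sub_t g : g \in t -> ideal_gen ([set` s] `\ f) g.
  rewrite mem_filter => /andP[gf gs]; apply: sub_gen_smallest.
  by split=> //; apply/eqP.
have [h genh ht] := is_ideal_common_divisor (ideal_gen_is_ideal _) sub_t.
have /dvdpP[u Dh] : G %| h.
  by apply: (ideal_gen_dvdp _ genh) => g [gs _]; apply: Gs.
(* Here [h] is a gcd of the elements other than [f]. Were its cofactor [u] over [G] a nonzero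
   constant, [h] would divide [f] and put [f] in the ideal of the others. *)
have /exists_monic_irred_dvdp[p irr_p pu] : size u != 1.
  apply/negP => /size_poly1P[c c0 Du]; apply: nf.
  have /dvdpP[v Df] : h %| f by rewrite Dh Du mul_polyC dvdpZl ?Gs.
  by rewrite {2}Df; apply: is_ideal_mull (ideal_gen_is_ideal _) genh.
have pGh : p * G %| h by rewrite Dh dvdp_mul.
have pGt g : g \in s -> g != f -> p * G %| g.
  by move=> gs gf; apply: dvdp_trans pGh (ht _ _); rewrite mem_filter gf.
exists p; split=> //; apply/negP => pGf.
(* If [p * G] divided [f] as well, it would divide all of [s], hence [G], making [p] a unit. *)
have /dvdpP[v DG] : p * G %| G.
  apply: (ideal_gen_dvdp _ genG) => g gs.
  by have [->|] := eqVneq g f; last exact: pGt.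
(* [G = 0] would force [f = 0], which lies in every ideal. *)
have G0 : G != 0.
  apply/negP => /eqP G0; have := Gs f fs; rewrite G0 dvd0p => /eqP f0.
  by apply: nf; rewrite f0; case: (ideal_gen_is_ideal ([set` s] `\ 0)).
have /eqP : 1 * G = v * p * G by rewrite mul1r -mulrA.
rewrite (inj_eq (mulIf G0)) => /eqP vp1.
have := dvdp_mull v (dvdpp p); rewrite -vp1 dvdp1 => /eqP sz_p.
by have := monic_irred_deg_gt0 irr_p; rewrite sz_p.
Qed.

(** The chosen primes are distinct, since [P g * G] divides every element of [s] except [g]. For
    fixed [f], the product of the other primes divides the quotient of [f] by [G], so its degree is
    at most [d]. *)
Lemma minimal_generating_set_irred_family d s : uniq s ->
  minimal_generating_set [set` s] -> (forall f, f \in s -> deg_le d f) ->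
  exists2 t : seq {poly F}, irred_family d t & size t = size s.
Proof.
move=> us /minimal_generating_set_primes[G HG] deg_s.
have /choice[P HP] : forall f, exists p, f \in s ->
    [/\ monic_irred p, ~~ (p * G %| f) &
        forall g, g \in s -> g != f -> p * G %| g].
  move=> f; case: (boolP (f \in s)) => [/HG[_ [p]]|_]; last by exists 0.
  by exists p.
have P_inj : {in s &, injective P}.
  move=> f g fs gs Pfg; apply/eqP; apply: contraT => fg.
  have [_ + _] := HP f fs; have [_ _] := HP g gs.
  by rewrite -Pfg => /(_ f fs fg) ->.
exists (map P s); last by rewrite size_map.
apply/and3P; split; first by rewrite map_inj_in_uniq.
  by apply/allP => _ /mapP[f fs ->]; have [] := HP f fs.
apply/allP => _ /mapP[f fs ->].
rewrite big_map (bigD1_seq f) //= addnC leq_add2r.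
pose t := [seq P g | g <- s & g != f].
have irr_t : all (@monic_irred F) t.
  apply/allP => _ /mapP[g + ->]; rewrite mem_filter => /andP[_ gs].
  by have [] := HP g gs.
have -> : (\sum_(g <- s | g != f) deg (P g) = \sum_(r <- t) deg r)%N.
  by rewrite big_map big_filter.
rewrite -deg_prod_monic_irred //.
have [/dvdpP[v Df] _] := HG f fs.
have f0 : f != 0.
  by have [_ + _] := HP f fs; apply: contra => /eqP->; rewrite dvdp0.
have v0 : v != 0 by apply: contraNneq f0 => v0; rewrite Df v0 mul0r.
have G0 : G != 0 by apply: contraNneq f0 => G0; rewrite Df G0 mulr0.
have : \prod_(p <- t) p %| v.
  apply: prod_monic_irred_dvdp => //.
    rewrite map_inj_in_uniq ?filter_uniq // => g h.
    by rewrite !mem_filter => /andP[_ gs] /andP[_ hs]; apply: P_inj.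
  move=> _ /mapP[g + ->]; rewrite mem_filter => /andP[gf gs].
  have [_ _ /(_ f fs)] := HP g gs; rewrite eq_sym gf Df dvdp_mul2r //.
  by apply.
move=> /(dvdp_leq v0) szt.
have szv : (size v <= size f)%N by rewrite dvdp_leq // Df dvdp_mulr.
have := leq_trans szt (leq_trans szv (deg_s f fs)).
by case: size.
Qed.

Lemma card_seq_II (T : choiceType) (s : seq T) : uniq s -> [set` s] #= `I_(size s).
Proof.
move=> us; have -> : [set` s] = [set` [fset x in s]%fset].
  by apply/seteqP; split => x /=; rewrite inE.
by apply/card_eq_fsetP; rewrite card_fseq undup_id.
Qed.

(** Bounded degree over a finite field makes [S] finite, hence given by a list without
    repetition. *)
Lemma minimal_generating_set_card d S : minimal_generating_set S ->
  (forall f, S f -> deg_le d f) -> S #<= `I_(max_family_size #|F| d).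
Proof.
move=> minS degS.
have /finite_seqP[s0 DS] : finite_set S.
  apply: (@sub_finite_set _ _ [set` map val (enum {poly_(d.+1) F})]) => //.
  move=> f /degS sz_f; apply/mapP; exists (NPoly sz_f) => //.
  by rewrite mem_enum.
have {}DS : S = [set` undup s0].
  by rewrite DS; apply/seteqP; split => x /=; rewrite mem_undup.
rewrite {}DS in minS degS *.
have [t fam_t sz_t] := minimal_generating_set_irred_family (undup_uniq s0) minS degS.
rewrite (card_le_eql (card_seq_II (undup_uniq s0))) card_le_II -sz_t.
exact: leq_max_family_size.
Qed.

Lemma minimal_generating_set_exists d : exists S : set {poly F},
  [/\ minimal_generating_set S, (forall f, S f -> deg_le d f) &
      S #= `I_(max_family_size #|F| d)].
Proof.
have [s /and3P[us irr_s sum_s] <-] := max_family_size_attained F d.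
pose f p := \prod_(r <- [seq r <- s | r != p]) r.
have irr_f p : all (@monic_irred F) [seq r <- s | r != p].
  by apply/allP => r; rewrite mem_filter => /andP[_ /(allP irr_s)].
have dvd_f p r : p \in s -> r \in s -> (p %| f r) = (p != r).
  move=> ps rs; rewrite dvdp_prod_monic_irred ?mem_filter ?ps ?andbT //.
  exact: (allP irr_s).
have f_inj : {in s &, injective f}.
  move=> p r ps rs fpr; apply/eqP; rewrite -[_ == _]negbK -dvd_f // -fpr.
  by rewrite dvd_f // eqxx.
exists [set` map f s]; split.
(* A proper subset omits some [f p]; all its elements are then divisible by [p], while [f p] is
   not. *)
- move=> S' [S's /existsNP[_ /not_implyP[/= /mapP[p ps ->] nS'p]]] eq_gen.
  have : p %| f p.
    apply: (@ideal_gen_dvdp _ S'); last first.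
      by rewrite eq_gen; apply: sub_gen_smallest; apply: map_f.
    move=> g S'g; have /mapP[r rs Dg] := S's g S'g.
    rewrite Dg dvd_f //; apply: contra_notN nS'p => /eqP ->.
    by rewrite -Dg.
  by rewrite dvd_f // eqxx.
- move=> _ /mapP[p ps ->]; rewrite /deg_le.
  have := allP sum_s p ps.
  rewrite (bigD1_seq p) //= addnC leq_add2r -big_filter -deg_prod_monic_irred //.
  by rewrite -/(f p); case: size.
- by rewrite -(size_map f); apply: card_seq_II; rewrite map_inj_in_uniq.
Qed.

End Polynomials.

(** * Logarithm estimates and the final bounds *)

(** This is [ln (1 + x) <= x] at [x = - 2^-1]. *)
Lemma ln2_ge_half (R : realType) : 2^-1 <= ln 2 :> R.
Proof.
have := @le_ln1Dx R (- 2^-1).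
have -> : 1 + - 2^-1 = 2^-1 :> R by field.
by rewrite lnV ?posrE // lerN2; apply; lra.
Qed.

Lemma ln_trunc_log (R : realType) (q d : nat) : (1 < q)%N -> (0 < d)%N ->
  (trunc_log q d)%:R * ln q%:R <= ln (d%:R : R) <= (trunc_log q d).+1%:R * ln q%:R.
Proof.
move=> q_gt1 d_gt0; have /andP[qd dq] := trunc_log_bounds q_gt1 d_gt0.
have q0 : 0 < q%:R :> R by rewrite ltr0n ltnW.
by rewrite !mulr_natl -!lnXn // -!natrX !ler_ln ?posrE ?ltr0n ?expn_gt0
  ?(ltnW q_gt1) // !ler_nat qd ltnW.
Qed.

Theorem proposition1p3 (R : realType) :
  exists (C : R) (lambda : nat -> nat -> nat),
    0 < C /\
    forall q d : nat, prime_power q -> (2 <= d)%N ->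
      [/\ q%:R `^ (- C) * (d%:R / ln d%:R) <= (lambda q d)%:R,
          (lambda q d)%:R <= q%:R `^ C * (d%:R / ln d%:R)
        & forall F : finFieldType, #|F| = q ->
            (forall S : set {poly F},
               minimal_generating_set S ->
               (forall f, S f -> deg_le d f) ->
               S #<= `I_(lambda q d)) /\
            (exists S : set {poly F},
               [/\ minimal_generating_set S,
                   (forall f, S f -> deg_le d f)
                 & S #= `I_(lambda q d)])].
Proof.
(* The upper bound costs [q ^ 4] and a factor [ln q <= q]; the lower bound costs only
   [2 * q <= q ^ 5]. *)
exists 5%:R, max_family_size; split=> // q d [p [k [p_pr k_gt0 Dq]]] d_ge2.
have d_gt0 : (0 < d)%N by apply: ltnW.
have [F0 _ cardF0] := pPrimePowerField p_pr k_gt0.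
rewrite -Dq in cardF0; have q_gt1 : (1 < q)%N by rewrite -cardF0 finNzRing_gt1.
have := max_family_size_lower F0 d_gt0; have := max_family_size_upper F0 d_gt0.
rewrite cardF0; set L := max_family_size q d; set t := trunc_log q d => up lo.
have /andP[] := ln_trunc_log R q_gt1 d_gt0; rewrite -/t => t_le le_t.
have q2 : 2 <= q%:R :> R by rewrite (ler_nat R 2).
have q0 : 0 < q%:R :> R by lra.
have ln2 := ln2_ge_half R.
have lnd : 2^-1 <= ln d%:R :> R.
  by apply: le_trans ln2 _; rewrite ler_ln ?posrE ?ltr0n // (ler_nat R 2).
have lnq : 2^-1 <= ln q%:R :> R.
  by apply: le_trans ln2 _; rewrite ler_ln ?posrE.
have lnd0 : 0 < ln d%:R :> R by lra.
rewrite powRN !powR_mulrn ?(ltW q0) //; split.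
- rewrite mulrA ler_pdivrMr // mulrC ler_pdivrMr ?exprn_gt0 //.
  (* For [t = 0] this is [ln d >= 1/2]; otherwise [t / 2 <= t * ln q <= ln d]. *)
  have t2 : (maxn 1 t)%:R <= 2 * ln d%:R :> R.
    case: (posnP t) => [->|t_gt0]; first by rewrite maxn0; lra.
    have t0 : 0 <= t%:R :> R by [].
    by rewrite (maxn_idPr t_gt0); nra.
  have lo' : d%:R <= q%:R * (maxn 1 t)%:R * L%:R :> R by rewrite -!natrM ler_nat.
  apply: (le_trans lo').
  have q_le : q%:R * 2 <= q%:R ^+ 5 :> R.
    by rewrite exprS ler_pM2l // (le_trans q2) // ler_eXnr //; lra.
  apply: le_trans (_ : q%:R * (2 * ln d%:R) * L%:R <= _).
    by rewrite ler_wpM2r // ler_pM2l.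
  rewrite [leLHS](_ : _ = L%:R * ln d%:R * (q%:R * 2)); last by ring.
  by rewrite ler_wpM2l // mulr_ge0 // ltW.
- rewrite mulrA ler_pdivlMr //.
  have up' : t.+1%:R * L%:R <= q%:R ^+ 4 * d%:R :> R.
    by rewrite -natrX -!natrM ler_nat.
  have lnq_le : ln q%:R <= q%:R :> R by apply/ltW/ln_sublinear.
  (* Replaces [ln d] by the larger [(t + 1) * ln q], so that [up'] applies. *)
  apply: le_trans (_ : t.+1%:R * L%:R * ln q%:R <= _).
    by rewrite [leRHS]mulrAC [leLHS]mulrC ler_wpM2r.
  by rewrite exprSr [leRHS]mulrAC ler_pM // ?mulr_ge0 //; lra.
- move=> F cardF; rewrite /L -cardF; split; last exact: minimal_generating_set_exists.
  by move=> S; apply: minimal_generating_set_card.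
Qed.
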